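(* For $n\ge 2$ let $S_n=(V,E)$ be the star graph with $n$ vertices $V=\{a_1,a_2,\dots,a_n\}$ and center $a_1$ (the edges are exactly $\{a_1,a_i\}$, $2\le i\le n$). Then the following hold. (i) For all $1<p<\infty$, $$\mathbf{C}_{S_3,p}=\frac{\big(1+2^{p/(p-1)}\big)^{(p-1)/p}}{3}<1.$$ (ii) If $p=1$, then $\mathbf{C}_{S_n,p}=1-\frac1n$. (iii) If $n=4$ and $0<p<1$, or $n\ge5$ and $\frac12\le p\le1$, then $\mathbf{C}_{S_n,p}=1-\frac1n$. Moreover, for every $0<p<\frac12$ there is a finite constant $C(p)$, depending only on $p$, such that $\mathbf{C}_{S_n,p}=1-\frac1n$ whenever $n\ge C(p)$.
   Context: For a finite connected graph $G=(V,E)$, let $d_G(u,v)$ be the number of edges in a shortest path connecting $u$ and $v$, and let $B(e,r)=\{m\in V: d_G(e,m)\le r\}$. For $f:V\to\mathbb{R}$ the centered Hardy–Littlewood maximal function is $$M_Gf(e)=\max_{r\ge 0}\frac{1}{|B(e,r)|}\sum_{m\in B(e,r)}|f(m)|,\qquad e\in V.$$ For $0<p<\infty$ the $p$-variation of $f:V\to\mathbb{R}$ is $$\operatorname{Var}_p f=\Big(\frac12\sum_{u\in V}\ \sum_{v\in V:\, d_G(u,v)=1}|f(u)-f(v)|^p\Big)^{1/p}.$$ Define $$\mathbf{C}_{G,p}=\sup_{f:V\to\mathbb{R},\ \operatorname{Var}_pf>0}\frac{\operatorname{Var}_pM_Gf}{\operatorname{Var}_pf}.$$ *)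

(* Defs.v *)
From HB Require Import structures.
From mathcomp Require Import all_boot all_order all_algebra.
From mathcomp Require Import all_classical all_reals all_analysis.
Set Implicit Arguments.
Unset Strict Implicit.
Unset Printing Implicit Defensive.
Import Order.TTheory GRing.Theory Num.Theory.
Local Open Scope classical_set_scope.
Local Open Scope ring_scope.

(* A finite simple graph is given by its adjacency relation [e], assumed
   symmetric, irreflexive and connected ([forall u v, connect e u v]); these
   properties are proved below for the star graphs. *)

(* Shortest walks in a connected graph have fewer than [#|T|] edges, so the
   search range [0, #|T|) is sufficient; vertices that are not connected get
   the junk value [#|T|]. *)
Definition gdist (T : finType) (e : rel T) (u v : T) : nat :=
  find (fun k : nat => [exists s : k.-tuple T, path e u s && (last u s == v)])
       (iota 0 #|T|).

Definition gball (R : realType) (T : finType) (e : rel T) (x : T) (r : R) :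
    {set T} :=
  [set m : T | (gdist e x m)%:R <= r]%SET.

Definition ball_avg (R : realType) (T : finType) (e : rel T) (f : T -> R)
    (x : T) (r : R) : R :=
  #|gball e x r|%:R^-1 * \sum_(m in gball e x r) `|f m|.

(* The supremum is a maximum: there are finitely many distinct balls, hence
   finitely many averages. *)
Definition graph_maximal (R : realType) (T : finType) (e : rel T) (f : T -> R) :
    T -> R :=
  fun x => sup [set ball_avg e f x r | r in [set r : R | 0 <= r]].

Definition pvar (R : realType) (T : finType) (e : rel T) (p : R)
    (f : T -> R) : R :=
  (2^-1 * \sum_(u : T) \sum_(v : T | gdist e u v == 1%N) `|f u - f v| `^ p)
    `^ p^-1.

(* Taken in the extended reals, so that a finite value includes boundedness. *)
Definition var_const (R : realType) (T : finType) (e : rel T) (p : R) :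
    \bar R :=
  ereal_sup [set (pvar e p (graph_maximal e f) / pvar e p f)%:E
            | f in [set f : T -> R | 0 < pvar e p f]].

(* The vertex a_i is the ordinal i - 1; the center a_1 is the ordinal 0. *)
Definition star (n : nat) : rel 'I_n :=
  fun i j => (val i == 0%N) != (val j == 0%N).
Arguments star n : clear implicits.

Lemma star_sym (n : nat) : symmetric (star n).
Proof. by move=> i j; rewrite /star eq_sym. Qed.

Lemma star_irr (n : nat) : irreflexive (star n).
Proof. by move=> i; rewrite /star eqxx. Qed.

Lemma star_connected (n : nat) (i j : 'I_n) : connect (star n) i j.
Proof.
case: n i j => [[] //|n] i j.
have to_center (k : 'I_n.+1) : connect (star n.+1) k ord0.
  have [/eqP k0|k0] := boolP (val k == 0%N).
    by rewrite (_ : k = ord0) ?connect0 //; apply: val_inj.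
  by apply: connect1; rewrite /star (negbTE k0).
apply: connect_trans (to_center i) _.
by rewrite (sym_connect_sym (@star_sym n.+1)).
Qed.

(* Main.v *)
Require Import Defs.
From mathcomp Require Import all_boot all_order all_algebra.
From mathcomp Require Import all_classical all_reals all_analysis.
From mathcomp Require Import ring lra.
Set Implicit Arguments.
Unset Strict Implicit.
Unset Printing Implicit Defensive.
Import Order.TTheory GRing.Theory Num.Theory.
Local Open Scope ring_scope.

(** Put x = |f| at the center, d_j = |f(a_j)| - x at the leaves, and let
    a = (sum of the d_j) / n be the global mean of |f| minus x. The balls of
    the star are the singletons, the edges and the whole graph, so M f at the
    center and at a leaf are maxima of at most three averages, and after
    subtracting x the difference of these two maxima depends on a and d_j only
    ([maximal_gap]). Since replacing f by |f| does not increase the variation,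
    the constant is the best C with
      sum_j (gap a d_j)^p <= C^p sum_j |d_j|^p
    for all real vectors d ([star_var_const]).

    Exponents p <= 1. Write N = n - 1 for the number of leaves, and Z, W for
    the sums of the positive and of the negative parts of the d_j, so that
    a = (Z - W) / n. With w_j the negative part of d_j, each leaf satisfies
      (gap a d_j)^p
        <= (N / n)^p (|d_j|^p + theta W^p (1 / N - w_j / W)),
    where theta = 1 if a >= 0 and theta = p if a < 0. The corrections sum to
    zero over the N leaves, which gives the upper bound 1 - 1/n
    ([star_gap_energy_le]). The leafwise bounds rest on the concavity of
    t^p and on t^p >= t for t in [0, 1]. They hold for every n >= 2, so one argument
    covers all the cases with p <= 1, and the threshold on n for p < 1/2 can
    be taken to be 0. A unit mass at a leaf attains the bound.

    Three vertices, p > 1. When d = (z, -w) with z >= w >= 0, the gaps are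
    (2 z + w) / 3 and 0, so Hoelder's inequality for the vectors (2, 1) and
    (z, w) gives the constant, and its equality case z = 2^(1/(p-1)), w = 1
    is admissible because z >= w. In every other sign pattern the bound
    follows from C >= 2/3 and 2 C^p >= 1, both of which are instances of the
    same Hoelder inequality. *)

(** * Distances and balls in the star *)

Lemma gdist_eq (T : finType) (e : rel T) (u v : T) (k : nat) :
  (k < #|T|)%N ->
  (exists s : k.-tuple T, path e u s && (last u s == v)) ->
  (forall (l : nat) (s : l.-tuple T), (l < k)%N -> path e u s ->
     last u s != v) ->
  gdist e u v = k.
Proof.
move=> kT [s us] lk; rewrite /gdist.
set a := (fun l : nat => _).
have hask : has a (iota 0 #|T|).
  apply/hasP; exists k; first by rewrite mem_iota.
  by apply/existsP; exists s.
apply/eqP; rewrite eqn_leq; apply/andP; split.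
  rewrite leqNgt; apply/negP => /(before_find 0%N).
  by rewrite nth_iota// add0n => /existsP; apply; exists s.
rewrite leqNgt; apply/negP => fk.
have := nth_find 0%N hask; rewrite nth_iota ?(ltn_trans fk kT)// add0n.
by move=> /existsP[t /andP[ut]]; apply/negP; exact: lk.
Qed.

Lemma star_gdist (n : nat) (u v : 'I_n.+2) :
  gdist (star n.+2) u v =
  if u == v then 0%N else if star n.+2 u v then 1%N else 2%N.
Proof.
have [<-|uv] := eqVneq u v.
  by apply: gdist_eq => //; [rewrite card_ord | exists [tuple] => /=].
have [suv|suv] := boolP (star n.+2 u v); apply: gdist_eq.
- by rewrite card_ord.
- by exists [tuple v]; rewrite /= suv eqxx.
- by move=> [|//] s _ _; rewrite (tuple0 s).
(* distinct non-adjacent vertices are two leaves, so there are at least three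
   vertices and distance 2 is within the search range *)
- rewrite card_ord; move: u v uv suv.
  by case: n => // -[[|[|u]] hu] [[|[|v]] hv].
- exists [tuple ord0; v]; rewrite /= eqxx !andbT; move: suv; rewrite /star/=.
  have : (val u == 0%N) && (val v == 0%N) = false.
    by apply/negbTE; apply: contra uv => /andP[/eqP u0 /eqP v0];
       apply/eqP/val_inj; rewrite /= u0 v0.
  by case: (val u == 0%N); case: (val v == 0%N).
- move=> [|[|//]] s _; first by rewrite (tuple0 s).
  case/tupleP: s => w s; rewrite (tuple0 s) /= andbT => uw.
  by apply: contra suv => /eqP <-.
Qed.

Lemma sup_attained (R : realType) (E : set R) (m : R) :
  E m -> ubound E m -> sup E = m.
Proof.
move=> Em ubm; apply/eqP; rewrite eq_le ge_sup//=; last by exists m.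
by apply: ub_le_sup => //; exists m.
Qed.

Section Star.
Variables (R : realType) (n : nat).
Implicit Types (f : 'I_n.+2 -> R) (p : R).

Notation leaf := (lift ord0).
Notation center := (ord0 : 'I_n.+2).

Lemma star_gball_center (r : R) : 0 <= r ->
  gball (star n.+2) center r = if r < 1 then [set center] else [set: 'I_n.+2].
Proof.
move=> r0; apply/setP => m; rewrite inE star_gdist.
have [<-|cm] := eqVneq center m; first by rewrite r0; case: ifP; rewrite !inE.
rewrite /star /= eq_sym eqb_id (_ : (m == 0%N :> nat) = false).
  by rewrite ltNge; case: (1 <= r); rewrite !inE // eq_sym (negbTE cm).
by apply/negbTE; rewrite -(inj_eq val_inj) eq_sym in cm.
Qed.

Lemma star_gball_leaf (j : 'I_n.+1) (r : R) : 0 <= r ->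
  gball (star n.+2) (leaf j) r =
  if r < 1 then [set leaf j]
  else if r < 2 then [set leaf j; center] else [set: 'I_n.+2].
Proof.
move=> r0; apply/setP => m; rewrite inE star_gdist.
have [<-|cm] := eqVneq (leaf j) m.
  by rewrite r0; do 2?[case: ifP => ?]; rewrite !inE ?eqxx.
rewrite eq_sym in cm; rewrite /star /=.
have -> : (m == 0%N :> nat) = (m == center) by rewrite -(inj_eq val_inj).
have r12 : 2 <= r -> 1 <= r by lra.
rewrite (ltNge r 1) (ltNge r 2); move: r12.
have [->|mc] := eqVneq m center => /=.
  by case: (1 <= r); case: (2 <= r); rewrite !inE ?eqxx ?orbT// => ->.
by case: (1 <= r); case: (2 <= r); rewrite !inE ?(negbTE cm) ?(negbTE mc)//
  => ->.
Qed.

(** * The maximal function and the variation on the star *)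

Definition star_mean f : R :=
  (`|f center| + \sum_(j < n.+1) `|f (leaf j)|) / n.+2%:R.

Lemma star_maximal_center f :
  graph_maximal (star n.+2) f center = Num.max `|f center| (star_mean f).
Proof.
have avgE (r : R) : 0 <= r -> ball_avg (star n.+2) f center r =
    if r < 1 then `|f center| else star_mean f.
  move=> r0; rewrite /ball_avg star_gball_center//; case: ifP => _.
    by rewrite cards1 big_set1 invr1 mul1r.
  rewrite cardsT card_ord mulrC /star_mean; congr (_ / _).
  by rewrite (eq_bigl xpredT) ?big_ord_recl// => i; rewrite inE.
apply: sup_attained.
  rewrite maxEle; case: ifP => _ /=.
    by exists 1; rewrite //= avgE// ltxx.
  by exists 0; rewrite //= avgE// ltr01.
by move=> _ [r /= r0 <-]; rewrite avgE// le_max; case: ifP; rewrite lexx ?orbT.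
Qed.

Lemma star_maximal_leaf f (j : 'I_n.+1) :
  graph_maximal (star n.+2) f (leaf j) =
  Num.max `|f (leaf j)|
    (Num.max ((`|f center| + `|f (leaf j)|) / 2) (star_mean f)).
Proof.
have avgE (r : R) : 0 <= r -> ball_avg (star n.+2) f (leaf j) r =
    if r < 1 then `|f (leaf j)|
    else if r < 2 then (`|f center| + `|f (leaf j)|) / 2 else star_mean f.
  move=> r0; rewrite /ball_avg star_gball_leaf//; case: ifP => _.
    by rewrite cards1 big_set1 invr1 mul1r.
  case: ifP => _.
    by rewrite cards2 big_setU1 ?inE//= big_set1 mulrC addrC.
  rewrite cardsT card_ord mulrC /star_mean; congr (_ / _).
  by rewrite (eq_bigl xpredT) ?big_ord_recl// => i; rewrite inE.
apply: sup_attained.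
  rewrite !maxEle; case: ifP => _ /=; [case: ifP => _ /=|].
  - exists 2; rewrite //= avgE// ltxx ifF//.
    by apply/negbTE; rewrite -leNgt; lra.
  - exists 1; rewrite //= avgE// ltxx ifT//; lra.
  - by exists 0; rewrite //= avgE// ltr01.
move=> _ [r /= r0 <-]; rewrite avgE// !le_max.
by do 2?[case: ifP => _]; rewrite lexx ?orbT.
Qed.

(** The p-th power of the p-variation: every edge joins the center to a leaf. *)
Definition star_energy p f : R :=
  \sum_(j < n.+1) `|f center - f (leaf j)| `^ p.

Lemma star_pvar p f :
  pvar (star n.+2) p f = star_energy p f `^ p^-1.
Proof.
rewrite /pvar; congr (_ `^ _).
have adjE (u v : 'I_n.+2) :
    (gdist (star n.+2) u v == 1%N) = star n.+2 u v.
  rewrite star_gdist; have [->|uv] := eqVneq u v; first by rewrite star_irr.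
  by case: (star _ u v).
rewrite big_ord_recl.
have -> : \sum_(v < n.+2 | gdist (star n.+2) center v == 1%N)
    `|f center - f v| `^ p = star_energy p f.
  rewrite big_mkcond big_ord_recl adjE star_irr /= add0r.
  by apply: eq_bigr => j _; rewrite adjE.
have -> : \sum_(j < n.+1) \sum_(v < n.+2 | gdist (star n.+2) (leaf j) v == 1%N)
    `|f (leaf j) - f v| `^ p = star_energy p f.
  apply: eq_bigr => j _; rewrite big_mkcond big_ord_recl adjE /= big1 ?addr0.
    by rewrite distrC.
  by move=> i _; rewrite adjE.
by field.
Qed.
End Star.

(** * Inequalities for real powers *)

Section Powers.
Variable R : realType.
Implicit Types (x y z w h p W Z N : R).

Lemma ler_powR2r p x y : 0 <= p -> 0 <= x -> x <= y -> x `^ p <= y `^ p.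
Proof.
move=> p0 x0 xy; apply: ge0_ler_powR => //; rewrite nnegrE//.
exact: le_trans xy.
Qed.

(** Young's inequality for x^p and 1 with the conjugate exponents 1/p and
    1/(1-p). *)
Lemma powR_bernoulli p x : 0 < p <= 1 -> 0 <= x -> x `^ p <= 1 + p * (x - 1).
Proof.
move=> /andP[p0]; rewrite le_eqVlt => /predU1P[->|p1] x0.
  by rewrite powRr1//; lra.
have q0 : 0 < 1 - p by lra.
have := @conjugate_powR R (x `^ p) 1 p^-1 (1 - p)^-1 (powR_ge0 _ _) ler01.
rewrite !invr_gt0 !invrK -powRrM divff ?gt_eqF// powRr1// powR1 mulr1.
by move=> /(_ p0 q0); rewrite addrC subrK => /(_ erefl); lra.
Qed.

(** By homogeneity this is t <= t^p for t = w / W in [0, 1]. When W = 0, also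
    w = 0, and the convention w / 0 = 0 makes the left side vanish. *)
Lemma powR_chord_le p w W : 0 < p <= 1 -> 0 <= w <= W ->
  W `^ p * (w / W) <= w `^ p.
Proof.
move=> /andP[p0 p1] /andP[]; rewrite le_eqVlt => /predU1P[<-|w0] wW.
  by rewrite mul0r mulr0 powR_ge0.
have W0 : 0 < W by exact: lt_le_trans wW.
have -> : w `^ p = W `^ p * (w / W) `^ p.
  by rewrite mulrC -powRM ?divr_ge0 ?(ltW w0) ?(ltW W0)// divfK ?gt_eqF.
rewrite ler_wpM2l ?powR_ge0// ger1_powR// divr_gt0//=.
by rewrite ler_pdivrMr// mul1r.
Qed.

Lemma powR_chord_ge p w W : 1 <= p -> 0 <= w <= W ->
  w `^ p <= W `^ p * (w / W).
Proof.
move=> p1 /andP[]; rewrite le_eqVlt => /predU1P[<-|w0] wW.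
  by rewrite mul0r mulr0 powR0// gt_eqF// (lt_le_trans ltr01).
have W0 : 0 < W by exact: lt_le_trans wW.
have -> : w `^ p = W `^ p * (w / W) `^ p.
  by rewrite mulrC -powRM ?divr_ge0 ?(ltW w0) ?(ltW W0)// divfK ?gt_eqF.
rewrite ler_wpM2l ?powR_ge0// ge1r_powR// divr_gt0//=.
by rewrite ler_pdivrMr// mul1r.
Qed.

(** Add the chord inequalities for the two parts of x + y. *)
Lemma powR_superadd p x y : 1 <= p -> 0 <= x -> 0 <= y ->
  x `^ p + y `^ p <= (x + y) `^ p.
Proof.
move=> p1 x0 y0; have [xy0|xy0] := eqVneq (x + y) 0.
  have -> : x = 0 by lra.
  have -> : y = 0 by lra.
  by rewrite addr0 !powR0 ?addr0// gt_eqF// (lt_le_trans ltr01).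
have := @powR_chord_ge p x (x + y) p1; have := @powR_chord_ge p y (x + y) p1.
rewrite x0 y0 lerDl lerDr x0 y0 => /(_ isT) hy /(_ isT) hx.
apply: le_trans (lerD hx hy) _.
by rewrite -mulrDr -mulrDl divff// mulr1.
Qed.

(** A leaf with positive increment z, when the mean is above the center. Its
    distance to the mean exceeds the share z N / (N + 1) by at most
    min(z, W) / (N + 1): the negative increments can lower the mean by no more
    than W / (N + 1), and the total Z - W stays nonnegative. Relative to that
    share the excess is s = min(z, W) / (z N); then (1 + s)^p <= 1 + s and the
    chord inequality give the additive term W^p / N. *)
Lemma above_mean_bound N p z W Z : 0 < N -> 0 < p <= 1 -> 0 <= z -> 0 <= W ->
    z <= Z -> W <= Z ->
  Num.max 0 (z - (Z - W) / (N + 1)) `^ p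
    <= (N / (N + 1)) `^ p * (z `^ p + W `^ p / N).
Proof.
move=> N0 /andP[p0 p1] z0 W0 zZ WZ.
have N10 : 0 < N + 1 by lra.
set u := Num.min z W.
have u0 : 0 <= u by rewrite /u le_min z0.
have uz : u <= z by rewrite ge_min lexx.
have uW : u <= W by rewrite ge_min lexx orbT.
have hb : Num.max 0 (z - (Z - W) / (N + 1)) <= N / (N + 1) * (z + u / N).
  have -> : N / (N + 1) * (z + u / N) = (N * z + u) / (N + 1).
    by field; rewrite !gt_eqF.
  rewrite ge_max divr_ge0 ?addr_ge0 ?mulr_ge0 ?(ltW N0) ?(ltW N10)//=.
  rewrite ler_pdivlMr// mulrBl divfK ?gt_eqF//.
  suff : z + W - Z <= u by lra.
  by rewrite le_min; apply/andP; split; lra.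
apply: le_trans (ler_powR2r (ltW p0) _ hb) _; first by rewrite le_max lexx.
rewrite powRM ?divr_ge0 ?addr_ge0 ?(ltW N0) ?(ltW N10)//; last first.
  by rewrite divr_ge0// ltW.
rewrite ler_wpM2l ?powR_ge0//.
move: z0; rewrite le_eqVlt => /predU1P[z0|z0].
  have -> : u = 0 by lra.
  by rewrite mul0r addr0 lerDl divr_ge0 ?powR_ge0// ltW.
have -> : z + u / N = z * (1 + u / z / N) by field; rewrite !gt_eqF.
have uzN : 0 <= u / z / N by rewrite !divr_ge0// ltW.
rewrite powRM ?(ltW z0)//; last by lra.
apply: (@le_trans _ _ (z `^ p * (1 + u / z / N))).
  by rewrite ler_wpM2l ?powR_ge0// ler1_powR//; lra.
rewrite mulrDr mulr1 lerD2l mulrA ler_pM2r ?invr_gt0//.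
apply: le_trans (powR_chord_le (W := z) _ _) _; rewrite ?p0 ?u0//.
by rewrite ler_powR2r// ltW.
Qed.

(** A leaf above the center, when the mean is below: its gap is z itself, so the
    factor (N / (N + 1))^p has to be paid for. By Bernoulli's inequality the
    inverse factor (1 + 1 / N)^p is at most 1 + p / N. *)
Lemma upper_leaf_bound N p z W : 0 < N -> 0 < p <= 1 -> 0 <= z <= W ->
  z `^ p <= (N / (N + 1)) `^ p * (z `^ p + p * (W `^ p / N)).
Proof.
move=> N0 p01 /andP[z0 zW]; have [p0 p1] := andP p01.
have N10 : 0 < N + 1 by lra.
have inv : (N / (N + 1)) `^ p * ((N + 1) / N) `^ p = 1.
  rewrite -powRM ?divr_ge0 ?(ltW N0) ?(ltW N10)//.
  by rewrite (_ : _ * _ = 1) ?powR1//; field; rewrite !gt_eqF.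
have {1}-> : z `^ p = (N / (N + 1)) `^ p * (((N + 1) / N) `^ p * z `^ p).
  by rewrite mulrA inv mul1r.
rewrite ler_wpM2l ?powR_ge0//.
have Nge : 0 <= (N + 1) / N by rewrite divr_ge0// ltW.
have bern := powR_bernoulli p01 Nge.
apply: le_trans (ler_wpM2r (powR_ge0 _ _) bern) _.
have -> : (N + 1) / N - 1 = N^-1 by field; rewrite gt_eqF.
rewrite mulrDl mul1r lerD2l -mulrA ler_pM2l// mulrC ler_pM2r ?invr_gt0//.
by rewrite ler_powR2r// ltW.
Qed.

(** The slope of t^p is at least p on [0, 1]. Multiplying Bernoulli's inequality
    for t / r by r^p, the slope obtained is p r^(p-1) >= p. *)
Lemma powR_secant p t r : 0 < p <= 1 -> 0 <= t -> r <= 1 -> t <= r ->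
  t `^ p <= r `^ p + p * (t - r).
Proof.
move=> p01 t0 r1 tr; have [p0 p1] := andP p01.
have [r0|r0] := eqVneq r 0.
  have -> : t = r by lra.
  by rewrite subrr mulr0 addr0.
have {}r0 : 0 < r by rewrite lt_neqAle eq_sym r0 (le_trans t0).
have q0 : 0 <= t / r by rewrite divr_ge0// ltW.
have q1 : t / r <= 1 by rewrite ler_pdivrMr ?mul1r.
have bern := powR_bernoulli p01 q0.
have rp : r <= r `^ p by rewrite ger1_powR// r0.
have tE : t = t / r * r by rewrite divfK ?gt_eqF.
rewrite {1}tE powRM ?(ltW r0)//.
apply: le_trans (ler_wpM2r (powR_ge0 _ _) bern) _.
have h : 0 <= p * (1 - t / r) * (r `^ p - r).
  by rewrite !mulr_ge0 ?(ltW p0)// ?subr_ge0.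
have -> : p * (t - r) = - (p * (1 - t / r) * r) by field; rewrite gt_eqF.
nra.
Qed.

(** A leaf below the center, when the mean is below too. The edge ball gives
    h <= w / 2 and the whole graph gives h <= W / (N + 1); together
    h <= N / (N + 1) min(w, W / N). The loss of min(w, W / N)^p against w^p is
    at least p W^p (w / W - 1 / N) by the slope bound, and this pays for the
    leaves above the center. *)
Lemma lower_leaf_bound N p w W h : 1 <= N -> 0 < p <= 1 -> 0 <= w <= W ->
    0 <= h -> h <= w / 2 -> h <= W / (N + 1) ->
  h `^ p <= (N / (N + 1)) `^ p * (w `^ p + p * (W `^ p * (N^-1 - w / W))).
Proof.
move=> N1 p01 /andP[w0 wW] h0 hw hW; have [p0 p1] := andP p01.
have N0 : 0 < N by lra.
have N10 : 0 < N + 1 by lra.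
have [W0|W0] := eqVneq W 0.
  have -> : h = 0 by lra.
  by rewrite W0 powR0 ?gt_eqF// mul0r mulr0 addr0 mulr_ge0 ?powR_ge0.
have {}W0 : 0 < W by rewrite lt_neqAle eq_sym W0 (le_trans w0).
set r := w / W; set s := Num.min r N^-1.
have r0 : 0 <= r by rewrite divr_ge0// ltW.
have r1 : r <= 1 by rewrite ler_pdivrMr ?mul1r.
have wE : w = W * r by rewrite /r; field; rewrite gt_eqF.
clearbody r.
have s0 : 0 <= s by rewrite le_min r0 invr_ge0 ltW.
have hs : h <= N / (N + 1) * (W * s).
  rewrite /s; case: (leP r N^-1) => _.
    rewrite -wE (le_trans hw)// mulrC ler_wpM2r// ler_pdivlMr//; lra.
  apply: le_trans hW _; rewrite le_eqVlt; apply/orP; left; apply/eqP.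
  by field; rewrite !gt_eqF.
apply: le_trans (ler_powR2r (ltW p0) h0 hs) _.
have Ws0 : 0 <= W * s by rewrite mulr_ge0// ltW.
rewrite powRM ?divr_ge0 ?(ltW N0) ?(ltW N10)//.
rewrite ler_wpM2l ?powR_ge0// wE !powRM ?(ltW W0)//.
rewrite (mulrCA p) -mulrDr ler_wpM2l ?powR_ge0//.
rewrite /s; case: (leP r N^-1) => hr; last first.
  by apply: powR_secant => //; [rewrite invr_ge0 ltW|exact: ltW].
by rewrite lerDl mulr_ge0 ?subr_ge0// ltW.
Qed.

End Powers.

(** * Reduction to an inequality for the increments at the leaves *)

(** The difference of M f between the center and a leaf, in coordinates where
    |f| vanishes at the center, equals d at the leaf and has mean a. *)
Definition maximal_gap (R : realType) (a d : R) : R :=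
  `|Num.max 0 a - Num.max d (Num.max (d / 2) a)|.

Section Gap.
Variable R : realType.
Implicit Types (a d x A : R).

Lemma maximal_gap_shift x y A :
  `|Num.max x A - Num.max y (Num.max ((x + y) / 2) A)|
    = maximal_gap (A - x) (y - x).
Proof.
rewrite /maximal_gap; congr `|_|.
have -> : Num.max x A = x + Num.max 0 (A - x).
  by rewrite addr_maxr addr0 (addrC x) subrK.
have -> : (y - x) / 2 = (x + y) / 2 - x by lra.
by rewrite -!addr_maxl opprB (addrC x) -addrA.
Qed.

Lemma maximal_gap_above a d : 0 <= a -> maximal_gap a d = Num.max 0 (d - a).
Proof.
move=> a0; rewrite /maximal_gap (max_r a0).
case: (leP (d / 2) a) => h2.
  case: (leP d a) => hd.
    by rewrite subrr normr0 max_l// subr_le0.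
  by rewrite distrC gtr0_norm ?subr_gt0// max_r// subr_ge0 ltW.
have da : a <= d by lra.
have dd : d / 2 <= d by lra.
by rewrite (max_l dd) distrC ger0_norm ?max_r// subr_ge0.
Qed.

Lemma maximal_gap_below_pos a d : a <= 0 -> 0 <= d -> maximal_gap a d = d.
Proof.
move=> a0 d0; rewrite /maximal_gap (max_l a0) (@max_l _ _ d).
  by rewrite sub0r normrN ger0_norm.
by rewrite ge_max; apply/andP; split; lra.
Qed.

Lemma maximal_gap_below_neg a d : a <= 0 -> d <= 0 ->
  maximal_gap a d = Num.min (- d / 2) (- a).
Proof.
move=> a0 d0; rewrite /maximal_gap (max_l a0) (@max_r _ _ d).
  have m0 : Num.max (d / 2) a <= 0 by rewrite ge_max a0 andbT; lra.
  by rewrite sub0r normrN ler0_norm// oppr_max mulNr.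
by rewrite le_max; apply/orP; left; lra.
Qed.

End Gap.

Section Reduction.
Variables (R : realType) (n : nat).
Implicit Types (f : 'I_n.+2 -> R) (d : 'I_n.+1 -> R) (p C : R).

Notation leaf := (lift ord0).
Notation center := (ord0 : 'I_n.+2).

Definition gap_energy p d : R :=
  \sum_(j < n.+1) maximal_gap ((\sum_(i < n.+1) d i) / n.+2%:R) (d j) `^ p.

Definition leaf_energy p d : R := \sum_(j < n.+1) `|d j| `^ p.

Lemma star_energy_maximal p f :
  star_energy p (graph_maximal (star n.+2) f)
    = gap_energy p (fun j => `|f (leaf j)| - `|f center|).
Proof.
apply: eq_bigr => j _.
rewrite star_maximal_center star_maximal_leaf maximal_gap_shift.
congr (maximal_gap _ _ `^ _).
rewrite /star_mean sumrB sumr_const card_ord -mulr_natl.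
have -> : (n.+2%:R : R) = n.+1%:R + 1 by rewrite natr1.
have : (n.+1%:R + 1 : R) != 0 by rewrite natr1 pnatr_eq0.
by move=> n0; field.
Qed.

Lemma leaf_energy_norm p f : 0 < p ->
  leaf_energy p (fun j => `|f (leaf j)| - `|f center|) <= star_energy p f.
Proof.
move=> p0; apply: ler_sum => j _; apply: ler_powR2r => //; first exact: ltW.
by rewrite (distrC (f center)) ler_dist_dist.
Qed.

(** Every vector d of increments comes from a nonnegative function, so the
    constant is decided by the inequality for d, in which the absolute values
    of f no longer occur. *)
Lemma star_var_const p C : 0 < p -> 0 <= C ->
    (forall d, gap_energy p d <= C `^ p * leaf_energy p d) ->
    (exists2 d, 0 < leaf_energy p d
              & gap_energy p d = C `^ p * leaf_energy p d) ->
  var_const (star n.+2) p = C%:E.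
Proof.
move=> p0 C0 upper [d d0 dE].
have pn0 : p != 0 by rewrite gt_eqF.
have rootE (v : R) : 0 <= v -> (C `^ p * v) `^ p^-1 = C * v `^ p^-1.
  by move=> v0; rewrite powRM ?powR_ge0// -powRrM divff// powRr1.
apply/eqP; rewrite eq_le; apply/andP; split.
  apply: ge_ereal_sup => _ [f /= f0 <-]; rewrite lee_fin ler_pdivrMr//.
  have V0 : 0 <= star_energy p f by apply: sumr_ge0 => j _; exact: powR_ge0.
  rewrite !star_pvar star_energy_maximal -rootE//.
  apply: ler_powR2r; first by rewrite invr_ge0 ltW.
    by apply: sumr_ge0 => j _; exact: powR_ge0.
  by rewrite (le_trans (upper _))// ler_wpM2l ?powR_ge0// leaf_energy_norm.
(* a large constant makes the function nonnegative, so that its values at the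
   leaves differ from the one at the center by exactly [d] *)
pose K := \sum_(j < n.+1) `|d j|.
pose f (i : 'I_n.+2) := K + (if unlift ord0 i is Some j then d j else 0).
have fc : f center = K by rewrite /f unlift_none addr0.
have fl j : f (leaf j) = K + d j by rewrite /f liftK.
have Kd j : `|d j| <= K.
  by rewrite /K (bigD1 j)//= lerDl sumr_ge0.
have K0 : 0 <= K by rewrite sumr_ge0.
have fld j : `|f (leaf j)| - `|f center| = d j.
  rewrite fc fl !ger0_norm//; first by rewrite addrC addKr.
  by have := Kd j; rewrite ler_norml => /andP[]; lra.
have Ef : star_energy p f = leaf_energy p d.
  by apply: eq_bigr => j _; rewrite fc fl opprD addNKr normrN.
have EMf : star_energy p (graph_maximal (star n.+2) f) = gap_energy p d.
  rewrite star_energy_maximal; congr (gap_energy _ _).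
  by apply/funext => j; exact: fld.
have pf0 : 0 < pvar (star n.+2) p f by rewrite star_pvar Ef powR_gt0.
apply: ereal_sup_ubound; exists f => //=.
by rewrite !star_pvar EMf Ef dE rootE ?ltW// mulfK// gt_eqF// powR_gt0.
Qed.

End Reduction.

(** * Exponents at most one *)

Section SmallExponent.
Variables (R : realType) (n : nat).
Implicit Types (d : 'I_n.+1 -> R) (p : R).

(** Bound each leaf with a correction proportional to 1 / N - w_j / W; these
    corrections cancel in the sum over the N leaves. *)
Lemma star_gap_energy_le p d : 0 < p <= 1 ->
  gap_energy p d <= (1 - n.+2%:R^-1) `^ p * leaf_energy p d.
Proof.
move=> p01; have [p0 p1] := andP p01.
set N : R := n.+1%:R; have N1 : 1 <= N by rewrite ler1n.
have N0 : 0 < N by lra.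
have n2E : (n.+2%:R : R) = N + 1 by rewrite natr1.
have cE : 1 - n.+2%:R^-1 = N / (N + 1).
  by rewrite n2E; field; rewrite gt_eqF//; lra.
pose W := \sum_(j < n.+1) Num.max 0 (- d j).
pose Z := \sum_(j < n.+1) Num.max 0 (d j).
have dE j : d j = Num.max 0 (d j) - Num.max 0 (- d j).
  by case: (leP 0 (d j)) => dj; case: (leP 0 (- d j)) => dj'; lra.
have sE : \sum_(j < n.+1) d j = Z - W.
  by rewrite /Z /W -sumrB; apply: eq_bigr.
have maxge0 (x : R) : 0 <= Num.max 0 x by rewrite le_max lexx.
have wW j : Num.max 0 (- d j) <= W.
  by rewrite /W (bigD1 j)//= lerDl sumr_ge0.
have zZ j : Num.max 0 (d j) <= Z.
  by rewrite /Z (bigD1 j)//= lerDl sumr_ge0.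
have W0 : 0 <= W by apply: sumr_ge0.
have WN0 : 0 <= W `^ p / N by rewrite divr_ge0 ?powR_ge0 ?ltW.
(* [th] is the factor theta of the correction; if W = 0 then W^p = 0, so that
   the correction vanishes whatever the value of w / 0 *)
suff [th hth] : exists th : R, forall j,
    maximal_gap ((Z - W) / (N + 1)) (d j) `^ p <= (N / (N + 1)) `^ p *
      (`|d j| `^ p + th * (W `^ p * (N^-1 - Num.max 0 (- d j) / W))).
  rewrite /gap_energy sE n2E -n2E cE n2E.
  apply: le_trans (ler_sum _ (fun j _ => hth j)) _.
  rewrite -mulr_sumr ler_wpM2l ?powR_ge0// big_split/= gerDl.
  rewrite -!mulr_sumr sumrB sumr_const card_ord -mulr_suml -/W.
  have [->|Wn0] := eqVneq W 0; first by rewrite powR0 ?gt_eqF// mul0r mulr0.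
  by rewrite divff// -mulr_natl divff ?gt_eqF// subrr !mulr0.
have [WZ|ZW] := leP W Z.
  exists 1 => j; rewrite mul1r maximal_gap_above ?divr_ge0 ?subr_ge0//; last lra.
  have [dj|dj] := leP 0 (d j).
    rewrite (@max_l _ _ 0 (- d j)) ?oppr_le0// mul0r subr0 ger0_norm//.
    apply: above_mean_bound => //.
    by have := zZ j; rewrite max_r.
  rewrite max_l; last first.
    suff : 0 <= (Z - W) / (N + 1) by lra.
    by rewrite divr_ge0 ?subr_ge0//; lra.
  rewrite powR0 ?gt_eqF// mulr_ge0 ?powR_ge0// mulrBr addrCA addr_ge0//.
  rewrite subr_ge0 max_r ?ltr0_norm ?oppr_ge0 ?(ltW dj)//.
  apply: powR_chord_le => //; rewrite oppr_ge0 ltW//=.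
  by have := wW j; rewrite max_r// oppr_ge0 ltW.
have a0 : (Z - W) / (N + 1) <= 0.
  by rewrite ler_pdivrMr ?mul0r ?subr_le0 ?ltW//; lra.
exists p => j; have [dj|dj] := leP 0 (d j).
  rewrite (@max_l _ _ 0 (- d j)) ?oppr_le0// mul0r subr0 ger0_norm//.
  rewrite maximal_gap_below_pos//; apply: upper_leaf_bound => //.
  by rewrite dj (le_trans _ (ltW ZW))//; have := zZ j; rewrite max_r.
have {}dj : d j <= 0 by exact: ltW.
have ndj : 0 <= - d j by rewrite oppr_ge0.
rewrite maximal_gap_below_neg// max_r// ler0_norm//.
apply: lower_leaf_bound => //.
- by rewrite ndj; have := wW j; rewrite max_r.
- by rewrite le_min oppr_ge0 a0 andbT; lra.
- by rewrite ge_min lexx.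
- rewrite ge_min -mulNr; apply/orP; right.
  rewrite ler_wpM2r ?invr_ge0//; first lra.
  have : 0 <= Z by apply: sumr_ge0.
  lra.
Qed.

Lemma star_var_const_le1 p : 0 < p <= 1 ->
  var_const (star n.+2) p = (1 - n.+2%:R^-1)%:E.
Proof.
move=> p01; have [p0 p1] := andP p01.
have n1 : (n.+2%:R : R)^-1 <= 1 by rewrite invf_le1 ?ler1n.
have n0 : 0 <= (n.+2%:R : R)^-1 by rewrite invr_ge0.
have pn0 : p != 0 by rewrite gt_eqF.
apply: star_var_const => //; first by rewrite subr_ge0.
  by move=> d; exact: star_gap_energy_le.
pose d (j : 'I_n.+1) : R := (j == ord0)%:R.
have dE : \sum_(j < n.+1) d j = 1 by rewrite big_ord_recl big1 ?addr0.
have leafE : leaf_energy p d = 1.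
  rewrite /leaf_energy big_ord_recl big1 => [|j _].
    by rewrite /d eqxx normr1 powR1 addr0.
  by rewrite /d normr0 powR0.
exists d; rewrite leafE// mulr1 /gap_energy dE mul1r big_ord_recl big1 => [|j _].
  by rewrite /d eqxx addr0 maximal_gap_above// max_r// subr_ge0.
by rewrite /d /= maximal_gap_above// sub0r max_l ?powR0// oppr_le0.
Qed.

End SmallExponent.

(** * Three vertices and exponents above one *)

Section ThreeVertices.
Variable R : realType.
Implicit Types (p C z w : R).

(** If u and v have the same sign, each gap is at most C times the increment,
    since C >= 2/3. If v < 0 < u and the mean is above the center, only the gap
    at u is nonzero and the assumed inequality is exactly what is needed. If the
    mean is below, the gaps are u and (w - u) / 3 with w = - v; then
    (w - u)^p <= w^p - u^p makes the claim linear in u^p <= w^p, and it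
    reduces to the ends 3^-p <= C^p and 1 <= 2 C^p. *)
Lemma star3_gap_energy_le p C (u v : R) : 1 < p -> 2 <= 3 * C ->
    1 <= 2 * C `^ p ->
    (forall z w : R, 0 <= z -> 0 <= w ->
       ((2 * z + w) / 3) `^ p <= C `^ p * (z `^ p + w `^ p)) ->
    v <= u ->
  maximal_gap ((u + v) / 3) u `^ p + maximal_gap ((u + v) / 3) v `^ p
    <= C `^ p * (`|u| `^ p + `|v| `^ p).
Proof.
move=> p1 C23 C12 hol vu.
have p0 : 0 < p by lra.
have C0 : 0 <= C by lra.
have pn0 : p != 0 by rewrite gt_eqF.
have scale (x d : R) : 0 <= x -> x <= C * `|d| -> x `^ p <= C `^ p * `|d| `^ p.
  by move=> x0 xd; rewrite -powRM//; apply: ler_powR2r => //; exact: ltW.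
have [v0|v0] := leP 0 v.
  have u0 : 0 <= u by exact: le_trans vu.
  rewrite !maximal_gap_above; [|lra|lra].
  rewrite mulrDr; apply: lerD; apply: scale; rewrite ?le_max ?lexx// ger0_norm//.
    by rewrite ge_max mulr_ge0//=; nra.
  by rewrite ge_max mulr_ge0//=; nra.
have [u0|u0] := leP u 0.
  rewrite !maximal_gap_below_neg; try lra.
  rewrite mulrDr; apply: lerD; apply: scale; rewrite ?le_min ?ge_min ?ler0_norm//.
  - by apply/andP; split; lra.
  - by apply/orP; left; nra.
  - by apply/andP; split; lra.
  - by apply/orP; left; nra.
  - by rewrite ltW.
rewrite (gtr0_norm u0) (ltr0_norm v0).
have [a0|a0] := leP 0 ((u + v) / 3).
  rewrite !maximal_gap_above// (@max_l _ _ 0 (v - _)); last lra.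
  rewrite powR0// addr0 max_r; last lra.
  have -> : u - (u + v) / 3 = (2 * u + - v) / 3 by lra.
  by apply: hol; lra.
rewrite maximal_gap_below_pos ?(ltW a0) ?(ltW u0)//.
rewrite maximal_gap_below_neg ?(ltW a0) ?(ltW v0)// min_r; last lra.
have -> : - ((u + v) / 3) = 3^-1 * (- v - u) by lra.
rewrite powRM//; last lra.
have super := @powR_superadd R p u (- v - u) (ltW p1) (ltW u0).
have {super} : u `^ p + (- v - u) `^ p <= (- v) `^ p.
  by apply: le_trans (super _) _; [lra|rewrite addrC subrK].
have : u `^ p <= (- v) `^ p by apply: ler_powR2r; lra.
have : 3^-1 `^ p <= C `^ p by apply: ler_powR2r; lra.
have : 0 <= 3^-1 `^ p :> R by exact: powR_ge0.
have : 0 <= u `^ p by exact: powR_ge0.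
(* the claim is linear in the powers [U], [V], [X]: it is the sum of the three
   products below *)
set t := 3^-1 `^ p; set c := C `^ p in C12 *; set U := u `^ p.
set X := (_ - _) `^ p; set V := (- v) `^ p.
move=> U0 t0 tc UV UXV.
have h1 : 0 <= t * (V - U - X) by rewrite mulr_ge0//; lra.
have h2 : 0 <= (c - t) * (V - U) by rewrite mulr_ge0//; lra.
have h3 : 0 <= (2 * c - 1) * U by rewrite mulr_ge0//; lra.
nra.
Qed.

(** With q = p / (p - 1) > 1 the claim is 1 + 2^q < 3^q, that is strict
    superadditivity: split b^q as b^(q - 1) b and compare with
    3^(q - 1) (1 + 2). *)
Lemma star3_const_lt1 p : 1 < p ->
  (1 + 2 `^ (p / (p - 1))) `^ ((p - 1) / p) / 3 < 1 :> R.
Proof.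
move=> p1; have r0 : 0 < p - 1 by lra.
have p0 : 0 < p by lra.
set q := p / (p - 1).
have q1 : q = (p - 1)^-1 + 1 by rewrite /q; field; rewrite gt_eqF.
have s0 : 0 < (p - 1)^-1 by rewrite invr_gt0.
have qV : (p - 1) / p = q^-1 by rewrite invf_div.
rewrite ltr_pdivrMr ?mul1r// qV.
have q0 : 0 < q by lra.
have -> : 3 = (3 `^ q) `^ q^-1 :> R.
  by rewrite -powRrM divff ?gt_eqF// powRr1.
apply: gt0_ltr_powR; rewrite ?invr_gt0 ?nnegrE ?powR_ge0//.
have splitE (b : R) : 0 < b -> b `^ q = b `^ (p - 1)^-1 * b.
  move=> b0; rewrite q1 powRD ?powRr1 ?ltW//.
  by apply/implyP => _; rewrite gt_eqF.
rewrite !splitE//.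
have h23 : 2 `^ (p - 1)^-1 < 3 `^ (p - 1)^-1 :> R.
  by apply: gt0_ltr_powR => //; rewrite ?nnegrE//; lra.
have h1 : 1 < 2 `^ (p - 1)^-1 :> R.
  by have := @gt0_ltr_powR R _ s0 1 2; rewrite powR1 !nnegrE => -> //; lra.
lra.
Qed.

Lemma star3_hoelder p z w : 1 < p -> 0 <= z -> 0 <= w ->
  ((2 * z + w) / 3) `^ p
    <= ((1 + 2 `^ (p / (p - 1))) `^ ((p - 1) / p) / 3) `^ p
       * (z `^ p + w `^ p).
Proof.
move=> p1 z0 w0; have r0 : 0 < p - 1 by lra.
have p0 : 0 < p by lra.
have q0 : 0 < p / (p - 1) by rewrite divr_gt0.
have conj : (p / (p - 1))^-1 + p^-1 = 1 by field; rewrite !gt_eqF.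
have := hoelder2 (ler0n R 2) ler01 z0 w0 q0 p0 conj.
rewrite mul1r powR1 (addrC _ 1) invf_div => hol.
have v0 : 0 <= z `^ p + w `^ p by rewrite addr_ge0 ?powR_ge0.
have -> : z `^ p + w `^ p = ((z `^ p + w `^ p) `^ p^-1) `^ p.
  by rewrite -powRrM mulVf ?gt_eqF// powRr1.
rewrite -powRM ?powR_ge0//; apply: ler_powR2r; first exact: ltW.
  by rewrite divr_ge0// addr_ge0// mulr_ge0.
by rewrite mulrAC ler_pM2r ?invr_gt0.
Qed.

Lemma star3_var_const p : 1 < p ->
  var_const (star 3) p
    = ((1 + 2 `^ (p / (p - 1))) `^ ((p - 1) / p) / 3)%:E.
Proof.
move=> p1; set C := (_ / 3); have p0 : 0 < p by lra.
have r0 : 0 < p - 1 by lra.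
have pn0 : p != 0 by rewrite gt_eqF.
have C0 : 0 <= C by rewrite divr_ge0 ?powR_ge0.
have hol z w : 0 <= z -> 0 <= w ->
    ((2 * z + w) / 3) `^ p <= C `^ p * (z `^ p + w `^ p).
  exact: star3_hoelder.
(* the values (1, 1) and (1, 0) of (z, w) *)
have C12 : 1 <= 2 * C `^ p.
  have := hol 1 1 ler01 ler01.
  by rewrite (_ : (2 * 1 + 1) / 3 = 1) ?powR1; lra.
have C23 : 2 <= 3 * C.
  have := hol 1 0 ler01 (lexx 0).
  rewrite powR1 powR0// !addr0 !mulr1.
  case: (leP 2 (3 * C)) => // C23 /le_gtF; apply: contra_eqT => _.
  by rewrite gt0_ltr_powR ?nnegrE//; lra.
apply: star_var_const => //.
  move=> d; rewrite /gap_energy /leaf_energy !big_ord_recl !big_ord0 !addr0.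
  set u := d _; set v := d _; have [vu|/ltW uv] := leP v u.
    exact: star3_gap_energy_le.
  have := star3_gap_energy_le p1 C23 C12 hol uv.
  by rewrite (addrC v) (addrC (maximal_gap _ v `^ p)) (addrC (`|v| `^ p)).
(* equality in Hoelder for (2, 1) and (t, 1) requires t^p proportional to
   2^(p / (p - 1)), and this choice also gives t^p = 2 t *)
pose t : R := 2 `^ (p - 1)^-1.
have t1 : 1 <= t.
  by rewrite -(powRr0 2) ler_powR ?ler1n// invr_ge0 ltW.
have tp : t `^ p = 2 `^ (p / (p - 1)) by rewrite -powRrM mulrC.
have t2 : t `^ p = 2 * t.
  rewrite tp (_ : p / (p - 1) = (p - 1)^-1 + 1); last first.
    by field; rewrite gt_eqF.
  by rewrite powRD ?powRr1 1?mulrC//; apply/implyP.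
pose d (j : 'I_2) : R := if j == ord0 then t else -1.
have dE : \sum_(j < 2) d j = t - 1 by rewrite !big_ord_recl big_ord0 addr0.
have leafE : leaf_energy p d = 1 + 2 * t.
  rewrite /leaf_energy !big_ord_recl big_ord0 addr0 /d /= normrN1 powR1 addrC.
  by rewrite ger0_norm ?t2//; lra.
exists d; first by rewrite leafE; lra.
have a0 : 0 <= (t - 1) / 3 by lra.
rewrite /gap_energy dE !big_ord_recl big_ord0 addr0 /d /=.
rewrite !maximal_gap_above// [in X in _ + X]max_l; last lra.
rewrite powR0// addr0 max_r; last lra.
have -> : t - (t - 1) / 3 = (1 + 2 * t) / 3 by lra.
rewrite leafE /C -tp t2; set Y := 1 + 2 * t; have Y0 : 0 < Y by rewrite /Y; lra.
rewrite !powRM ?powR_ge0 ?(ltW Y0)// mulrAC; congr (_ * _).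
rewrite -powRrM divfK// -[X in _ * X]powRr1 ?(ltW Y0)// -powRD ?subrK//.
by apply/implyP => _; rewrite gt_eqF.
Qed.

End ThreeVertices.

Theorem theorem2 (R : realType) :
  (forall p : R, 1 < p ->
     var_const (star 3) p
       = ((1 + 2 `^ (p / (p - 1))) `^ ((p - 1) / p) / 3)%:E
     /\ (1 + 2 `^ (p / (p - 1))) `^ ((p - 1) / p) / 3 < 1)
  /\
  (forall n : nat, (2 <= n)%N ->
     var_const (star n) (1 : R) = (1 - n%:R^-1)%:E)
  /\
  ((forall (n : nat) (p : R),
      (n = 4%N /\ 0 < p < 1) \/ ((5 <= n)%N /\ 2^-1 <= p <= 1) ->
      var_const (star n) p = (1 - n%:R^-1)%:E)
   /\
   (forall p : R, 0 < p < 2^-1 ->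
      exists c : R, forall n : nat, (2 <= n)%N -> c <= n%:R ->
        var_const (star n) p = (1 - n%:R^-1)%:E)).
Proof.
have small (n : nat) (p : R) : (2 <= n)%N -> 0 < p <= 1 ->
    var_const (star n) p = (1 - n%:R^-1)%:E.
  by case: n => [|[|n]]// _; exact: star_var_const_le1.
split=> [p p1|]; first by split; [exact: star3_var_const|exact: star3_const_lt1].
split=> [n n2|]; first by apply: small => //; lra.
split=> [n p [[-> p01]|[n5 p01]]|p p01].
- by apply: small => //; lra.
- by apply: small; [exact: leq_trans n5|lra].
- by exists 0 => n n2 _; apply: small => //; lra.
Qed.
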